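(* Let $\{c_n\}_{n\ge1}$ be a real sequence with $\sum_{n=1}^\infty |c_n|<+\infty$ and $\sum_{n=N}^{\infty}(c_n)^2>0$ for every $N\ge1$. Let $f(x):=\sum_{n=1}^\infty c_n\varphi^{(n)}(x)$ and $f_N(x):=\sum_{n=1}^{N-1}c_n\varphi^{(n)}(x)$ for $x\in[0,1]$. If $$\lim_{N\to\infty}\frac{(c_N)^2}{\sum_{n=N}^\infty (c_n)^2}=0,$$ then for every $u\in\mathbb{R}$, $$\lim_{N\to\infty}P\left(\left\{x\in[0,1]:\frac{f(x)-f_N(x)-\frac12\sum_{n=N}^\infty c_n}{\sqrt{\frac1{12}\sum_{n=N}^\infty (c_n)^2}}\le u\right\}\right)=\int_{-\infty}^u\frac{1}{\sqrt{2\pi}}e^{-t^2/2}\,dt.$$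
   Context: The tent map on $[0,1]$ is $\varphi(x)=2x$ for $x\in[0,1/2]$ and $\varphi(x)=2(1-x)$ for $x\in[1/2,1]$; it is extended to $\mathbb{R}$ by $\varphi(x):=\varphi(x-[x])$, and $\varphi^{(n)}$ denotes the $n$-fold iterate of $\varphi$, so that $\varphi^{(n)}(x)=\varphi(2^{n-1}x)$. $P$ denotes Lebesgue measure on $[0,1]$. *)

(* Defs.v *)
From HB Require Import structures.
From mathcomp Require Import all_boot all_order all_algebra.
From mathcomp Require Import all_classical all_reals all_analysis.
Set Implicit Arguments. Unset Strict Implicit. Unset Printing Implicit Defensive.
Import Order.TTheory GRing.Theory Num.Theory.
Import numFieldNormedType.Exports.
Local Open Scope classical_set_scope.
Local Open Scope ring_scope.

Definition tent {R : realType} (x : R) : R :=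
  let y := x - (Num.floor x)%:~R in
  if y <= 2^-1 then 2 * y else 2 * (1 - y).

Definition tent_iter {R : realType} (n : nat) (x : R) : R := iter n tent x.

Definition rsum_from {R : realType} (N : nat) (u : nat -> R) : R :=
  limn (fun M => \sum_(N <= k < M) u k).

Definition Phi {R : realType} (u : R) : \bar R :=
  (\int[@lebesgue_measure R]_(t in `]-oo, u]) 
     ((Num.sqrt (2 * pi))^-1 * expR (- (t ^+ 2) / 2))%:E)%E.

(* Main.v *)
(* Lindeberg replacement without characteristic functions. Write X_n for
   phi^(n) - 1/2. Each y in [0,1] has the two preimages y/2 and 1 - y/2 under
   the tent map, with equal weights, so averaging over the first coordinate
   replaces c_N X_N by +- c_N (1 - y)/2 and turns the later terms into the same
   sum started at y. Let H(t, x) = P(x + sqrt(t) Z <= v), with Z standard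
   normal; it solves H_t = H_xx / 2. Up to third order in c_N, folding out one
   term amounts to (c_N^2 / 2) ((1 - y)^2 / 4) H_xx, and (1 - y)^2 / 4 = 1/12 + p(y), where p is
   an eigenfunction of the transfer operator for the eigenvalue 1/4. The 1/12
   is a time step c_N^2 / 12 of the heat flow; the p-part is of smaller order,
   since the correlation of p with a Lipschitz function of the later sum
   contracts by 1/4 at each step, at the cost of one coefficient. Telescoping
   turns E H(t, S) into H(t + Var S, 0) up to an error bounded by
   max |c_n| / sigma, and at a small time t the function H(t, .) sandwiches the
   indicator of a half-line. *)
Require Import Defs.
From HB Require Import structures.
From mathcomp Require Import all_boot all_order all_algebra.
From mathcomp Require Import all_classical all_reals all_analysis.
From mathcomp Require Import measurable_realfun ring lra.
Import Order.TTheory GRing.Theory Num.Theory.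
Import numFieldNormedType.Exports.
Local Open Scope classical_set_scope.
Local Open Scope ring_scope.

(** * Means over the unit interval *)

Section continuous_arith.
Context {R : realType}.
Implicit Types F G : R -> R.

Lemma continuous_cst (k : R) : continuous (fun _ : R => k).
Proof. by move=> x; exact: cvg_cst. Qed.

Lemma continuous_id : continuous (fun x : R => x).
Proof. by move=> x; exact: cvg_id. Qed.

Lemma continuous_add F G : continuous F -> continuous G ->
  continuous (fun x => F x + G x).
Proof. by move=> cF cG x; exact: (cvgD (cF x) (cG x)). Qed.

Lemma continuous_sub F G : continuous F -> continuous G ->
  continuous (fun x => F x - G x).
Proof. by move=> cF cG x; exact: (cvgB (cF x) (cG x)). Qed.

Lemma continuous_mul F G : continuous F -> continuous G ->
  continuous (fun x => F x * G x).
Proof. by move=> cF cG x; exact: (cvgM (cF x) (cG x)). Qed.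

Lemma continuous_compose F G : continuous F -> continuous G ->
  continuous (fun x => F (G x)).
Proof. by move=> cF cG x; exact: (cvg_comp _ _ (cG x) (cF (G x))). Qed.

End continuous_arith.

Ltac cont := repeat lazymatch goal with
  | |- continuous (fun x => @GRing.mul _ _ _) => apply: continuous_mul
  | |- continuous (@GRing.mul _ _) => apply: continuous_mul
  | |- continuous (fun x => @GRing.exp _ _ 2) => apply: continuous_mul
  | |- continuous (fun x => @GRing.add _ _ (@GRing.opp _ _)) => apply: continuous_sub
  | |- continuous (fun x => @GRing.add _ _ _) => apply: continuous_add
  | |- _ => first [ done | exact: continuous_cst | exact: continuous_id ]
  end.

Definition mean01 {R : realType} (F : R -> R) : R :=
  \int[@lebesgue_measure R]_(x in `[0, 1]) F x.

Section mean01.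
Context {R : realType}.
Implicit Types F G : R -> R.

Lemma mean01_integrable F : continuous F ->
  (@lebesgue_measure R).-integrable `[0, 1] (EFin \o F).
Proof.
move=> cF; apply: continuous_compact_integrable; first exact: segment_compact.
exact: continuous_subspaceT.
Qed.

Lemma mean01_cst (k : R) : mean01 (fun=> k) = k.
Proof.
rewrite /mean01 Rintegral_cst//= lebesgue_measure_itv/= lte_fin ltr01.
by rewrite oppr0 adde0 mulr1.
Qed.

Lemma eq_mean01 {F} G : (forall x, 0 <= x <= 1 -> F x = G x) ->
  mean01 F = mean01 G.
Proof. by move=> FG; apply: eq_Rintegral => x; rewrite inE/= in_itv/= => /FG. Qed.

Lemma mean01_le F G : continuous F -> continuous G ->
  (forall x, 0 <= x <= 1 -> F x <= G x) -> mean01 F <= mean01 G.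
Proof.
move=> cF cG FG; apply: le_Rintegral => //; exact: mean01_integrable.
Qed.

Lemma mean01D F G : continuous F -> continuous G ->
  mean01 (fun x => F x + G x) = mean01 F + mean01 G.
Proof. by move=> cF cG; apply: RintegralD => //; exact: mean01_integrable. Qed.

Lemma mean01Z k F : continuous F -> mean01 (fun x => k * F x) = k * mean01 F.
Proof. by move=> cF; apply: RintegralZl => //; exact: mean01_integrable. Qed.

Lemma mean01_dist F G k : continuous F -> continuous G ->
  (forall x, 0 <= x <= 1 -> `|F x - G x| <= k) -> `|mean01 F - mean01 G| <= k.
Proof.
move=> cF cG FG.
rewrite ler_distlC; apply/andP; split.
  rewrite lerBlDr -[X in _ <= _ + X]mean01_cst -mean01D//; last by cont.
  apply: mean01_le => //; first by cont.
  by move=> x /FG; rewrite ler_distlC => /andP[]; rewrite lerBlDr.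
rewrite -[X in _ <= _ + X]mean01_cst -mean01D//; last by cont.
apply: mean01_le => //; first by cont.
by move=> x /FG; rewrite ler_distlC => /andP[].
Qed.

Lemma mean01_FTC F (A : R -> R) : continuous F ->
  (forall x : R, 0 <= x <= 1 -> is_derive x 1 A (F x)) -> mean01 F = A 1 - A 0.
Proof.
move=> cF dA.
have cA (x : R) : 0 <= x <= 1 -> {for x, continuous A}.
  by move=> /dA dAx; apply/differentiable_continuous/derivable1_diffP.
rewrite /mean01 /Rintegral (@continuous_FTC2 _ F A)//.
- exact: continuous_subspaceT.
- split.
  + move=> x; rewrite in_itv/= => /andP[x0 x1].
    by have [] : is_derive x 1 A (F x) by apply: dA; rewrite !ltW.
  + by apply/cvg_at_right_filter/cA; rewrite lexx ler01.
  + by apply/cvg_at_left_filter/cA; rewrite lexx ler01.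
- move=> x; rewrite in_itv/= => /andP[x0 x1].
  by have dAx := dA x; rewrite derive1E; apply/derive_val/dAx; rewrite !ltW.
Qed.

(* The right-hand side is the mean of the transfer operator of the tent map
   applied to F. *)
Lemma mean01_fold F : continuous F ->
  mean01 F = mean01 (fun y => 2^-1 * (F (2^-1 * y) + F (1 - 2^-1 * y))).
Proof.
move=> cF.
(* Starting the integral at -2 puts [0, 1] in the interior of the range where [A] is
   differentiable. *)
pose A x := \int[@lebesgue_measure R]_(t in `[(-2), x]) F t.
have dA (x : R) : -1 < x < 2 -> is_derive x 1 A (F x).
  move=> /andP[x1 x2].
  have [||||] := @continuous_FTC1_closed R F (-2) x 3.
  - by lra.
  - apply: continuous_compact_integrable; first exact: segment_compact.
    exact: continuous_subspaceT.
  - by lra.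
  - exact: cF.
  - by move=> dA <-; rewrite derive1E; exact: derivableP.
have cl : continuous (fun y : R => 2^-1 * y).
  by cont.
have cr : continuous (fun y : R => 1 - 2^-1 * y).
  by cont.
have -> : mean01 F = A 1 - A 0.
  by apply: mean01_FTC => // x x01; apply: dA; lra.
(* By the chain rule [B] is an antiderivative of the folded integrand; at y = 1 the two branches
   meet at 1/2 and their contributions cancel. *)
pose B : R -> R := (fun y => A (2^-1 * y)) - (fun y => A (1 - 2^-1 * y)).
have BE : B 1 - B 0 = A 1 - A 0.
  rewrite /B !fctE mulr1 mulr0 subr0.
  by rewrite (_ : 1 - 2^-1 = 2^-1 :> R); [ring|field].
rewrite -BE; apply/esym/mean01_FTC => [|x x01].
  by cont; apply: (@continuous_compose _ F).
  have dl : is_derive x 1 (fun y : R => 2^-1 * y) 2^-1.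
    by apply: (is_derive_eq (is_deriveZ 2^-1 (is_derive_id x 1))); rewrite [LHS]mulr1.
  have dr : is_derive x 1 (fun y : R => 1 - 2^-1 * y) (- 2^-1).
    by have := is_deriveB (is_derive_cst (1 : R) x (1 : R)) dl; rewrite sub0r.
  have dAl : is_derive (2^-1 * x) 1 A (F (2^-1 * x)) by apply: dA; lra.
  have dAr : is_derive (1 - 2^-1 * x) 1 A (F (1 - 2^-1 * x)) by apply: dA; lra.
  have dl' := is_derive1_comp dAl dl.
  have dr' := @is_derive1_comp _ A (fun y => 1 - 2^-1 * y) x _ _ dAr dr.
  by apply: is_derive_eq (is_deriveB dl' dr') _; ring.
Qed.
End mean01.

(** * Weighted sums along tent map orbits and Lindeberg replacement *)

(* A version of [tent] that is continuous on the whole line and agrees with it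
   on [0, 1]. *)
Definition ctent {R : realType} (x : R) : R := Num.max 0 (1 - `|2 * x - 1|).

(** Each iterate is centred at its mean 1/2. Indexing starts at the identity, so that removing the
    head of [s] leaves a sum of the same kind started at [ctent x]. *)
Definition tent_sum {R : realType} (s : seq R) (x : R) : R :=
  \sum_(i < size s) s`_i * (iter i ctent x - 2^-1).

Section tent_sum.
Context {R : realType}.
Implicit Types (s : seq R) (x y : R).

Lemma tentE x : 0 <= x <= 1 -> tent x = ctent x.
Proof.
move=> /andP[x0 x1]; rewrite /tent /ctent.
(* The right endpoint stands apart: its floor is 1, so [tent] evaluates its first branch at 0. *)
have [->|xn1] := eqVneq x 1.
  rewrite (_ : 1 = 1%:~R :> R)// intrKfloor subrr mulr0 invr_ge0 ler0n.
  rewrite mulr1 (_ : 2 - 1%:~R = 1 :> R); last by rewrite /=; ring.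
  by rewrite normr1 subrr maxxx.
have -> : Num.floor x = 0.
  by apply/eqP; rewrite floor_eq//= x0 lt_neqAle xn1.
rewrite subr0; case: ifPn => [xh|]; last rewrite -ltNge => xh.
- rewrite ler0_norm; last by lra.
  by rewrite max_r; lra.
- rewrite ger0_norm; last by lra.
  by rewrite max_r; lra.
Qed.

Lemma ctent01 x : 0 <= ctent x <= 1.
Proof.
rewrite /ctent le_max lexx/= ge_max ler01/= lerBlDr lerDl.
exact: normr_ge0.
Qed.

Lemma ctentl y : 0 <= y <= 1 -> ctent (2^-1 * y) = y.
Proof.
move=> y01; rewrite /ctent ler0_norm; last by lra.
by rewrite max_r; lra.
Qed.

Lemma ctentr y : 0 <= y <= 1 -> ctent (1 - 2^-1 * y) = y.
Proof.
move=> y01; rewrite /ctent ger0_norm; last by lra.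
by rewrite max_r; lra.
Qed.

Lemma continuous_ctent : continuous (@ctent R).
Proof.
move=> x; apply: (@continuous_max R R (fun=> 0) (fun x => 1 - `|2 * x - 1|)).
  exact: cvg_cst.
apply: continuous_sub; first exact: continuous_cst.
apply: (@continuous_compose _ (fun x => `|x|) (fun x => 2 * x - 1)); last by cont.
exact: norm_continuous.
Qed.

Lemma iter_ctent01 i x : 0 <= x <= 1 -> 0 <= iter i ctent x <= 1.
Proof. by case: i => // i _; exact: ctent01. Qed.

Lemma iter_tentE i x : 0 <= x <= 1 -> tent_iter i x = iter i ctent x.
Proof.
move=> x01; rewrite /tent_iter; elim: i => //= i ->.
by rewrite tentE// iter_ctent01.
Qed.

Lemma tent_sum_nil x : tent_sum [::] x = 0.
Proof. by rewrite /tent_sum big_ord0. Qed.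

Lemma tent_sum_cons a s x :
  tent_sum (a :: s) x = a * (x - 2^-1) + tent_sum s (ctent x).
Proof.
rewrite /tent_sum big_ord_recl/=; congr (_ + _); apply: eq_bigr => i _.
by rewrite -iterS iterSr.
Qed.

Lemma continuous_tent_sum s : continuous (tent_sum s).
Proof.
elim: s => [|a s cs].
  have -> : tent_sum [::] = (fun=> 0 : R) by apply/funext => x; exact: tent_sum_nil.
  exact: continuous_cst.
have -> : tent_sum (a :: s) = (fun x => a * (x - 2^-1) + tent_sum s (ctent x)).
  by apply/funext => x; exact: tent_sum_cons.
by cont; apply: (@continuous_compose _ (tent_sum s)) => //; exact: continuous_ctent.
Qed.

(** Both preimages of y lead to the same tail, and the head x - 1/2 takes the opposite values -(1 -
    y)/2 and (1 - y)/2 there. The weight [g] lets one identity serve for [eigen4] and for the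
    constant 1. *)
Lemma mean01_tent_sum_cons (g F : R -> R) a s : continuous g -> continuous F ->
  mean01 (fun x => g x * F (tent_sum (a :: s) x)) =
  mean01 (fun y => 2^-1 *
    (g (2^-1 * y) * F (tent_sum s y - a * (2^-1 * (1 - y))) +
     g (1 - 2^-1 * y) * F (tent_sum s y + a * (2^-1 * (1 - y))))).
Proof.
move=> cg cF; rewrite mean01_fold; last first.
  cont; apply: (@continuous_compose _ F) => //; exact: continuous_tent_sum.
apply: eq_mean01 => y y01; congr (_ * (_ * F _ + _ * F _)).
  by rewrite tent_sum_cons ctentl//; field.
by rewrite tent_sum_cons ctentr//; field.
Qed.

(* The eigenfunction of the transfer operator of the tent map for the
   eigenvalue 1/4. *)
Definition eigen4 x := (1 - x) ^+ 2 / 4 - 12^-1.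

Lemma continuous_eigen4 : continuous eigen4.
Proof. by rewrite /eigen4; cont. Qed.

Lemma eigen4E y :
  2^-1 * (eigen4 (2^-1 * y) + eigen4 (1 - 2^-1 * y)) = eigen4 y / 4.
Proof. by rewrite /eigen4; field. Qed.

Lemma eigen4_le y : 0 <= y <= 1 -> `|eigen4 y| <= 6^-1.
Proof. by move=> y01; rewrite ler_norml /eigen4; nra. Qed.

(** Folding preserves the mean and divides [eigen4] by 4, so the mean is a quarter of itself. *)
Lemma mean01_eigen4 : mean01 eigen4 = 0.
Proof.
suff : mean01 eigen4 = 4^-1 * mean01 eigen4 by lra.
rewrite [LHS]mean01_fold; last exact: continuous_eigen4.
rewrite -mean01Z; last exact: continuous_eigen4.
by apply: eq_mean01 => y _; rewrite eigen4E mulrC.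
Qed.

Lemma continuous_comp_tent_sum (F : R -> R) s : continuous F ->
  continuous (fun x => F (tent_sum s x)).
Proof.
by move=> cF; apply: (@continuous_compose _ F) => //; exact: continuous_tent_sum.
Qed.

(** Folding out the head replaces [eigen4] by a quarter of itself and moves the argument of [F] by
    at most beta/2. The bound does not grow with the length of [s], because 1/4 + 1/12 <= 1. *)
Lemma mean01_eigen4_tent_sum (F : R -> R) (L beta : R) s : continuous F ->
  (forall x y, `|F x - F y| <= L * `|x - y|) ->
  0 <= L -> 0 <= beta -> (forall a, a \in s -> `|a| <= beta) ->
  `|mean01 (fun x => eigen4 x * F (tent_sum s x))| <= L * beta.
Proof.
move=> cF lipF L0 b0; elim: s => [_|a s IH sb].
  rewrite (_ : mean01 _ = mean01 (fun x => F 0 * eigen4 x)).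
    rewrite mean01Z; last exact: continuous_eigen4.
    by rewrite mean01_eigen4 mulr0 normr0 mulr_ge0.
  by apply: eq_mean01 => x _; rewrite tent_sum_nil mulrC.
have {IH} := IH (fun x xs => sb x (mem_behead (s := a :: s) xs)).
have ab : `|a| <= beta by apply: sb; rewrite mem_head.
have cS := continuous_tent_sum s.
have cFS := @continuous_comp_tent_sum F s cF.
have ce := continuous_eigen4.
rewrite mean01_tent_sum_cons//; set m' := mean01 _; set m := mean01 _ => m'L.
(* The factor 1/12 collects two branches of weight 1/2, the bound 1/6 on [eigen4], and the shift
   beta/2. *)
have : `|m - 4^-1 * m'| <= L * beta / 12.
  rewrite -mean01Z; last by cont.
  apply: mean01_dist.
  - cont.
    + by apply: (@continuous_compose _ eigen4) => //; cont.
    + by apply: (@continuous_compose _ F) => //; cont.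
    + by apply: (@continuous_compose _ eigen4) => //; cont.
    + by apply: (@continuous_compose _ F) => //; cont.
  - by cont.
  move=> y y01; have := eigen4E y.
  have p1 : `|eigen4 (2^-1 * y)| <= 6^-1 by apply: eigen4_le; lra.
  have p2 : `|eigen4 (1 - 2^-1 * y)| <= 6^-1 by apply: eigen4_le; lra.
  move: p1 p2; set p1 := eigen4 _; set p2 := eigen4 _; set p := eigen4 _ => hp1 hp2 pE.
  set h := a * _; set S := tent_sum s y.
  have hb : `|h| <= beta / 2.
    rewrite normrM; apply: ler_pM => //.
    by rewrite ler_norml; lra.
  have lipLh : L * `|h| <= L * (beta / 2) by rewrite ler_wpM2l.
  have D1 : `|F (S - h) - F S| <= L * (beta / 2).
    by apply: (le_trans (lipF _ _)); rewrite (_ : S - h - S = - h) ?normrN//; ring.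
  have D2 : `|F (S + h) - F S| <= L * (beta / 2).
    by apply: (le_trans (lipF _ _)); rewrite (_ : S + h - S = h)//; ring.
  rewrite (_ : _ - _ =
      2^-1 * (p1 * (F (S - h) - F S) + p2 * (F (S + h) - F S))); last first.
    rewrite (_ : 4^-1 * (p * F S) = (p / 4) * F S); last by ring.
    by rewrite -pE; ring.
  rewrite normrM ger0_norm//.
  have := ler_normD (p1 * (F (S - h) - F S)) (p2 * (F (S + h) - F S)).
  rewrite !normrM.
  have := ler_pM (normr_ge0 _) (normr_ge0 _) hp1 D1.
  have := ler_pM (normr_ge0 _) (normr_ge0 _) hp2 D2.
  by lra.
have : 0 <= L * beta by rewrite mulr_ge0.
move: m'L; rewrite !ler_norml; lra.
Qed.

(* [K] stands for the second space derivative of [H]. *)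
Lemma lindeberg_tent_sum (H K : R -> R -> R) (delta C beta : R) :
  (forall t, delta <= t -> continuous (H t)) ->
  (forall t, delta <= t -> continuous (K t)) ->
  (forall t x h, delta <= t ->
    `|H t (x - h) + H t (x + h) - 2 * H t x - h ^+ 2 * K t x| <= C * `|h| ^+ 3) ->
  (forall t r x, delta <= t -> 0 <= r ->
    `|H (t + r) x - H t x - r / 2 * K t x| <= C * r ^+ 2) ->
  (forall t x y, delta <= t -> `|K t x - K t y| <= C * `|x - y|) ->
  0 <= C -> 0 <= beta <= 1 ->
  forall s t, delta <= t -> (forall a, a \in s -> `|a| <= beta) ->
  `|mean01 (fun x => H t (tent_sum s x)) - H (t + 12^-1 * \sum_(a <- s) a ^+ 2) 0|
    <= C * beta * \sum_(a <- s) a ^+ 2.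
Proof.
move=> cH cK taylorH timeH lipK C0 /andP[b0 b1]; elim => [|a s IH] t dt sb.
  rewrite big_nil !mulr0 addr0 (_ : mean01 _ = H t 0) ?subrr ?normr0//.
  by rewrite -[RHS]mean01_cst; apply: eq_mean01 => x _; rewrite tent_sum_nil.
have sb' x (xs : x \in s) : `|x| <= beta by apply: sb; rewrite in_cons xs orbT.
have ab : `|a| <= beta by apply: sb; rewrite mem_head.
(* The variance of a (x - 1/2) for x uniform on [0, 1], spent as a time step of the heat flow. *)
pose r := a ^+ 2 / 12.
have r0 : 0 <= r by rewrite divr_ge0// sqr_ge0.
have dtr : delta <= t + r by rewrite (le_trans dt)// lerDl.
have := IH (t + r) dtr sb'.
have := @mean01_eigen4_tent_sum (K t) C beta s (cK t dt)
  (fun x y => lipK t x y dt) C0 b0 sb'.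
rewrite big_cons mulrDr -/(a ^+ 2) (_ : 12^-1 * a ^+ 2 = r) ?addrA; last first.
  by rewrite /r mulrC.
rewrite (_ : mean01 (fun x => H t _) =
    mean01 (fun x => 1 * H t (tent_sum (a :: s) x))); last first.
  by apply: eq_mean01 => x _; rewrite mul1r.
rewrite mean01_tent_sum_cons//; [|exact: continuous_cst|exact: cH].
set m := mean01 (fun y => 2^-1 * _); set mp := mean01 (fun x => eigen4 x * _).
set m' := mean01 (fun x => H (t + r) _); set w := H _ 0; set sm := \sum_(_ <- _) _.
move=> mpC IHs.
have cS := continuous_tent_sum s.
have ce := continuous_eigen4.
have cHS : continuous (fun x => H (t + r) (tent_sum s x)).
  exact: (continuous_comp_tent_sum _ _ (cH _ dtr)).
have cKS : continuous (fun x => K t (tent_sum s x)).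
  exact: (continuous_comp_tent_sum _ _ (cK _ dt)).
have a2 : 0 <= a ^+ 2 by exact: sqr_ge0.
have Ca2 : 0 <= C * beta * a ^+ 2 by do 2!apply: mulr_ge0 => //.
(* The budget C beta a^2 of this step is split in two. The first half pays for the space and time
   Taylor errors, once h^2 is written as a^2 ([eigen4 y] + 1/12) and the 1/12 is absorbed by the
   time step. *)
have : `|m - (m' + a ^+ 2 / 2 * mp)| <= C * beta * a ^+ 2 / 2.
  rewrite -mean01Z; last by cont.
  rewrite -mean01D//; last by cont.
  apply: mean01_dist.
  - cont.
    + by apply: (@continuous_compose _ (H t)); [exact: cH|cont].
    + by apply: (@continuous_compose _ (H t)); [exact: cH|cont].
  - by cont.
  move=> y y01; set h := a * _; set S := tent_sum s y.
  have := taylorH t S h dt; have := timeH t r S dt r0.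
  have hE : h ^+ 2 = a ^+ 2 * (eigen4 y + 12^-1) by rewrite /h /eigen4; field.
  have hb : `|h| <= `|a| / 2.
    rewrite normrM ler_wpM2l//.
    by rewrite ler_norml; lra.
  have h3 : C * `|h| ^+ 3 <= C * beta * a ^+ 2 / 2.
    have hb3 : `|h| ^+ 3 <= (`|a| / 2) ^+ 3.
      by apply: lerXn2r => //; rewrite nnegrE ?divr_ge0.
    have a3 : `|a| ^+ 3 <= beta * a ^+ 2.
      by rewrite -[a ^+ 2]real_normK ?num_real// exprS ler_wpM2r// sqr_ge0.
    have := ler_wpM2l C0 (le_trans hb3 _ : _ <= beta * a ^+ 2 / 2).
    rewrite !mulrA; apply.
    have : 0 <= `|a| ^+ 3 by exact: exprn_ge0.
    by rewrite expr_div_n; lra.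
  have r2 : C * r ^+ 2 <= C * beta * a ^+ 2 / 8.
    (* The time error is of order a^4; since beta <= 1, one factor a^2 can be traded for beta. *)
    have a1 : a ^+ 2 <= beta.
      rewrite -[a ^+ 2]real_normK ?num_real// expr2.
      by rewrite (le_trans (ler_pM _ _ ab ab))// ler_piMl.
    have := ler_wpM2l C0 (ler_wpM2l a2 a1).
    by rewrite /r; lra.
  rewrite hE; move: h3 r2; rewrite !ler_norml /r; lra.
(* The second half pays for the correlation of [eigen4] with [K t] of the remaining sum. *)
have : `|a ^+ 2 / 2 * mp| <= C * beta * a ^+ 2 / 2.
  rewrite normrM ger0_norm ?divr_ge0//.
  by have := ler_wpM2l (divr_ge0 a2 (ler0n _ 2)) mpC; lra.
rewrite mulrDr; move: IHs; rewrite !ler_norml; lra.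
Qed.

End tent_sum.

(** * Taylor estimates *)

Section derive_pointwise.
Context {R : realType}.
Implicit Types F G : R -> R.

Lemma is_derive_mul F G (x dF dG : R) : is_derive x 1 F dF ->
  is_derive x 1 G dG ->
  is_derive x 1 (fun y => F y * G y) (dF * G x + F x * dG).
Proof.
move=> hF hG; apply: is_derive_eq (is_deriveM hF hG) _.
by rewrite addrC; congr (_ + _); exact: mulrC.
Qed.

Lemma is_derive_compose F G (x dF dG : R) : is_derive (G x) 1 F dF ->
  is_derive x 1 G dG -> is_derive x 1 (fun y => F (G y)) (dF * dG).
Proof. exact: is_derive1_comp. Qed.


End derive_pointwise.
Arguments is_derive_mul {R F G x dF dG}.
Arguments is_derive_compose {R F G x dF dG}.

Section mean_value.
Context {R : realType}.
Implicit Types F : R -> R.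

Lemma is_derive_scale (a x : R) : is_derive x 1 (fun y : R => a * y) a.
Proof.
by apply: (is_derive_eq (is_deriveZ a (is_derive_id x 1))); exact: mulr1.
Qed.

(** The interval is given by [Num.min] and [Num.max] so that increments of either sign are
    covered. *)
Lemma mean_value F F1 (x y : R) :
  (forall z : R, Num.min x y <= z <= Num.max x y -> is_derive z 1 F (F1 z)) ->
  exists2 z, Num.min x y <= z <= Num.max x y & F y - F x = F1 z * (y - x).
Proof.
wlog xy : x y / x <= y => [hw|].
  have [/hw//|yx] := orP (le_total x y).
  rewrite minC maxC => /(hw _ _ yx)[z zxy E]; exists z => //.
  by rewrite -[RHS]opprK -mulrN opprB -E opprB.
rewrite min_l// max_r// => dF.
have [||z zxy E] := @MVT_segment R F F1 x y xy.
- by move=> z; rewrite in_itv/= => /andP[xz zy]; apply: dF; rewrite !ltW.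
- apply: continuous_in_subspaceT => z; rewrite inE/= in_itv/= => /dF dFz.
  by apply/differentiable_continuous/derivable1_diffP.
by exists z.
Qed.

Lemma between_dist (x y z : R) : Num.min x y <= z <= Num.max x y ->
  `|z - x| <= `|y - x|.
Proof.
have [xy|yx] := leP x y => zxy.
  by rewrite !ger0_norm; lra.
by rewrite !ler0_norm; lra.
Qed.

Lemma lipschitz_of_derive F F1 (L x y : R) :
  (forall z : R, Num.min x y <= z <= Num.max x y -> is_derive z 1 F (F1 z)) ->
  (forall z : R, Num.min x y <= z <= Num.max x y -> `|F1 z| <= L) ->
  `|F x - F y| <= L * `|x - y|.
Proof.
move=> /mean_value[z /[swap] E zxy] /(_ _ zxy) F1z.
by rewrite distrC E normrM distrC ler_wpM2r.
Qed.

Lemma taylor1_lipschitz F F1 (L x y : R) :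
  (forall z : R, Num.min x y <= z <= Num.max x y -> is_derive z 1 F (F1 z)) ->
  (forall z : R, Num.min x y <= z <= Num.max x y ->
    `|F1 z - F1 x| <= L * `|z - x|) ->
  0 <= L -> `|F y - F x - F1 x * (y - x)| <= L * `|y - x| ^+ 2.
Proof.
move=> /mean_value[z /[swap] E zxy] /(_ _ zxy) F1z L0.
rewrite E -mulrBl normrM expr2 mulrA ler_wpM2r//.
by rewrite (le_trans F1z)// ler_wpM2l// between_dist.
Qed.

Lemma taylor2_lipschitz F F1 F2 (L x h : R) :
  (forall z : R, is_derive z 1 F (F1 z)) ->
  (forall z : R, is_derive z 1 F1 (F2 z)) ->
  (forall y z, `|F2 y - F2 z| <= L * `|y - z|) -> 0 <= L ->
  `|F (x + h) - F x - F1 x * h - h ^+ 2 / 2 * F2 x| <= L * `|h| ^+ 3.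
Proof.
move=> dF dF1 lipF2 L0.
(* The increment of [P] from x to x + h is the remainder to be bounded, and its derivative [P1] is
   the first-order remainder of [F1] at x. The mean value theorem thus reduces the claim to
   [taylor1_lipschitz]. *)
pose P z := F z - F1 x * z - (z - x) ^+ 2 / 2 * F2 x.
pose P1 z := F1 z - F1 x - (z - x) * F2 x.
have dP (z : R) : is_derive z 1 P (P1 z).
  have dsq : is_derive z 1 (fun z => 2^-1 * ((z - x) * (z - x)) * F2 x)
      ((z - x) * F2 x).
    have dz : is_derive z 1 (fun z => z - x) 1.
      have := is_deriveB (is_derive_id z 1) (is_derive_cst x z 1).
      by move/is_derive_eq; apply; rewrite subr0.
    have := is_derive_mul (is_derive_mul (is_derive_cst (2^-1 : R) z (1 : R))
      (is_derive_mul dz dz)) (is_derive_cst (F2 x) z (1 : R)).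
    by move/is_derive_eq; apply; rewrite /=; field.
  have := is_deriveB (is_deriveB (dF z) (is_derive_scale (F1 x) z)) dsq.
  by congr is_derive; apply/funext => w; rewrite /P /=; rewrite !fctE; field.
have [z zx E] := @mean_value P P1 x (x + h) (fun z _ => dP z).
have hz : `|z - x| <= `|h|.
  by rewrite (le_trans (between_dist _ _ _ zx))// addrAC subrr add0r.
have P1z : `|P1 z| <= L * `|h| ^+ 2.
  have := @taylor1_lipschitz F1 F2 L x z (fun z _ => dF1 z) (fun z _ => lipF2 z x) L0.
  rewrite /P1 mulrC => /le_trans; apply; rewrite ler_wpM2l//.
  by apply: lerXn2r.
rewrite (_ : _ - _ = P (x + h) - P x); last by rewrite /P; field.
rewrite E (addrAC x) subrr add0r normrM exprSr mulrA ler_wpM2r//.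
Qed.

(** The expansions at h and -h are added; the first-order terms cancel and the two remainders give
    the factor 2. *)
Lemma second_difference_lipschitz F F1 F2 (L x h : R) :
  (forall z : R, is_derive z 1 F (F1 z)) ->
  (forall z : R, is_derive z 1 F1 (F2 z)) ->
  (forall y z, `|F2 y - F2 z| <= L * `|y - z|) -> 0 <= L ->
  `|F (x - h) + F (x + h) - 2 * F x - h ^+ 2 * F2 x| <= 2 * L * `|h| ^+ 3.
Proof.
move=> dF dF1 lipF2 L0.
have := @taylor2_lipschitz F F1 F2 L x h dF dF1 lipF2 L0.
have := @taylor2_lipschitz F F1 F2 L x (- h) dF dF1 lipF2 L0.
by rewrite normrN sqrrN !ler_norml; lra.
Qed.
End mean_value.

(** * The normal distribution function and its heat flow *)

Section gaussian.
Context {R : realType}.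
Implicit Types x y z t : R.

Definition gpdf x : R := (Num.sqrt (2 * pi))^-1 * expR (- (x ^+ 2) / 2).

Definition gcdf x : R := fine (Phi x).

Lemma gpdfE : gpdf = normal_pdf 0 1.
Proof.
apply/funext => x; rewrite /gpdf normal_pdfE ?oner_neq0// /normal_peak /normal_fun.
by rewrite subr0 expr1n mul1r mulr_natl.
Qed.

Lemma integrable_gpdf (A : set R) : measurable A ->
  (@lebesgue_measure R).-integrable A (EFin \o gpdf).
Proof.
move=> mA; rewrite gpdfE; apply: integrableS (integrable_normal_pdf 0 1) => //.
Qed.

Lemma PhiE x : Phi x = normal_prob 0 1 `]-oo, x].
Proof. by rewrite /Phi /normal_prob -gpdfE. Qed.

Lemma Phi_fin_num x : Phi x \is a fin_num.
Proof. by rewrite PhiE fin_num_measure. Qed.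

Lemma gcdf_ge0 x : 0 <= gcdf x.
Proof. by rewrite /gcdf PhiE fine_ge0// measure_ge0. Qed.

Lemma gcdf_le1 x : gcdf x <= 1.
Proof. by rewrite -lee_fin /gcdf fineK ?Phi_fin_num// PhiE probability_le1. Qed.

Lemma gcdf_le x y : x <= y -> gcdf x <= gcdf y.
Proof.
move=> xy; rewrite /gcdf fine_le ?Phi_fin_num// !PhiE le_measure ?inE//.
exact: subitvPr.
Qed.

(** The identity as a random variable with the standard normal law: its distribution function is
    [Phi], which yields the limits at both infinities. *)
Let normal_id : {RV (normal_prob 0 1) >-> R} :=
  HB.pack_for {mfun _ >-> _} (idfun : measurableTypeR R -> R)
    (isMeasurableFun.Build _ _ (measurableTypeR R) R _ (@measurable_id _ _ setT)).

Lemma cvg_gcdfy : gcdf x @[x --> +oo] --> (1 : R).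
Proof.
have := @cvg_cdfy1 _ _ _ _ normal_id.
rewrite (_ : cdf normal_id = @Phi R); last by apply/funext => x; rewrite PhiE.
by move/fine_cvg.
Qed.

Lemma cvg_gcdfNy : gcdf x @[x --> -oo] --> (0 : R).
Proof.
have := @cvg_cdfNy0 _ _ _ _ normal_id.
rewrite (_ : cdf normal_id = @Phi R); last by apply/funext => x; rewrite PhiE.
by move/fine_cvg.
Qed.

Lemma is_derive_gcdf x : is_derive x 1 gcdf (gpdf x).
Proof.
have cg : {for x, continuous gpdf}.
  by rewrite gpdfE; apply: continuous_normal_pdf; rewrite oner_neq0.
have x1 : x < x + 1 by rewrite ltrDl.
have [||] := @continuous_FTC1 R gpdf -oo%O x (x + 1) x1 _ _ cg.
- exact: integrable_gpdf.
- by rewrite ltNyr.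
by move=> dG <-; rewrite derive1E; exact: derivableP.
Qed.

Lemma is_derive_gpdf x : is_derive x 1 gpdf (- x * gpdf x).
Proof.
have dx2 : is_derive x 1 (fun y => - 2^-1 * (y * y)) (- x).
  have := is_derive_mul (is_derive_cst (- 2^-1 : R) x (1 : R))
    (is_derive_mul (is_derive_id x 1) (is_derive_id x 1)).
  by move/is_derive_eq; apply; rewrite /=; field.
have := is_derive_mul (is_derive_cst ((Num.sqrt (2 * pi))^-1 : R) x (1 : R))
  (@is_derive_compose R expR (fun y => - 2^-1 * (y * y)) x _ _ (is_derive_expR _) dx2).
have E y : expR (- 2^-1 * (y * y)) = expR (- (y ^+ 2) / 2).
  by congr expR; field.
rewrite E (_ : (fun y => _) = gpdf); last by apply/funext => y; rewrite E.
by move=> /is_derive_eq; apply; rewrite /gpdf /=; ring.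
Qed.

Lemma is_derive_gpdf1 x :
  is_derive x 1 (fun x => - x * gpdf x) ((x ^+ 2 - 1) * gpdf x).
Proof.
have := is_derive_mul (is_deriveN (is_derive_id x 1)) (is_derive_gpdf x).
by move=> /is_derive_eq; apply; rewrite /= opprfctE; ring.
Qed.

Lemma gpdf_ge0 x : 0 <= gpdf x.
Proof. by rewrite mulr_ge0 ?expR_ge0// invr_ge0 sqrtr_ge0. Qed.

(** Squaring 1 + x^2 <= 4 exp(x^2/4) gives exactly the exponential that the density cancels. The
    weight dominates every polynomial factor met in the derivatives of the heat flow. *)
Lemma gpdf_bound x : (1 + x ^+ 2) ^+ 2 * gpdf x <= 16.
Proof.
have sq1 : (Num.sqrt (2 * pi))^-1 <= 1 :> R.
  rewrite invf_le1 ?sqrtr_gt0; last by rewrite mulr_gt0// pi_gt0.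
  rewrite -[leLHS]sqrtr1 ler_wsqrtr//.
  by have := pi_ge2 R; lra.
have e4 : 1 + x ^+ 2 <= 4 * expR (x ^+ 2 / 4).
  by have := expR_ge1Dx (x ^+ 2 / 4); lra.
have x0 : 0 <= 1 + x ^+ 2 by rewrite addr_ge0// sqr_ge0.
have := ler_pM x0 x0 e4 e4.
rewrite mulrACA -expRD (_ : x ^+ 2 / 4 + _ = x ^+ 2 / 2); last by field.
rewrite -expr2 => h; rewrite /gpdf mulrCA.
have h' : (1 + x ^+ 2) ^+ 2 * expR (- (x ^+ 2) / 2) <= 16.
  have := ler_wpM2r (expR_ge0 (- (x ^+ 2) / 2)) h.
  by rewrite -(mulrA (4 * 4)) -expRD mulNr subrr expR0; lra.
apply: le_trans h'; rewrite ler_piMl// mulr_ge0 ?sqr_ge0 ?expR_ge0//.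
Qed.

Lemma gpdf_poly_bound (k x : R) : `|k| <= (1 + x ^+ 2) ^+ 2 -> `|k * gpdf x| <= 16.
Proof.
move=> kx; rewrite normrM (ger0_norm (gpdf_ge0 x)).
by rewrite (le_trans _ (gpdf_bound x))// ler_wpM2r// gpdf_ge0.
Qed.

(* [heat v t] is the solution at time t of the heat equation [u_t = u_xx / 2]
   started from the indicator function of ]-oo, v]. *)
Definition heat v t x := gcdf ((Num.sqrt t)^-1 * (v - x)).

Definition heat_xx v t x : R :=
  let z := (Num.sqrt t)^-1 * (v - x) in (Num.sqrt t)^-1 ^+ 2 * (- z * gpdf z).

Lemma is_derive_affine (r v x : R) : is_derive x 1 (fun x => r * (v - x)) (- r).
Proof.
have := is_derive_mul (is_derive_cst (r : R) x (1 : R))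
  (is_deriveB (is_derive_cst (v : R) x (1 : R)) (is_derive_id x 1)).
by move/is_derive_eq; apply; rewrite /=; ring.
Qed.

Lemma is_derive_heat v t x :
  is_derive x 1 (heat v t) (- (Num.sqrt t)^-1 * gpdf ((Num.sqrt t)^-1 * (v - x))).
Proof.
rewrite mulrC.
exact: (is_derive_compose (is_derive_gcdf _) (is_derive_affine _ _ _)).
Qed.

Lemma is_derive_heat_x v t x :
  is_derive x 1 (fun x => - (Num.sqrt t)^-1 * gpdf ((Num.sqrt t)^-1 * (v - x)))
    (heat_xx v t x).
Proof.
have := is_derive_mul (is_derive_cst (- (Num.sqrt t)^-1 : R) x (1 : R))
 (is_derive_compose (is_derive_gpdf _) (is_derive_affine (Num.sqrt t)^-1 v x)).
by move/is_derive_eq; apply; rewrite /= /heat_xx; ring.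
Qed.

Lemma is_derive_heat_xx v t x (r := (Num.sqrt t)^-1) (z := r * (v - x)) :
  is_derive x 1 (heat_xx v t) (- r ^+ 3 * ((z ^+ 2 - 1) * gpdf z)).
Proof.
have := is_derive_mul (is_derive_cst ((r ^+ 2) : R) x (1 : R))
 (is_derive_compose (is_derive_gpdf1 _) (is_derive_affine r v x)).
by move/is_derive_eq; apply; rewrite /= /z; ring.
Qed.

Lemma is_derive_invsqrt t : 0 < t ->
  is_derive t 1 (fun t => (Num.sqrt t)^-1) (- 2^-1 * (Num.sqrt t)^-1 ^+ 3).
Proof.
move=> t0; have st : 0 < Num.sqrt t by rewrite sqrtr_gt0.
have := is_deriveV (lt0r_neq0 st) (is_derive1_sqrt t0).
move/is_derive_eq; apply.
transitivity (- Num.sqrt t ^- 2 * (2 * Num.sqrt t)^-1 : R) => //.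
by field; rewrite lt0r_neq0.
Qed.

(** The heat equation: r = t^(-1/2) has derivative -r^3/2, so with z = r (v - x) the chain rule
    produces -r^2 z/2 times the density at z. *)
Lemma is_derive_heat_t v t x : 0 < t ->
  is_derive t 1 (fun t => heat v t x) (2^-1 * heat_xx v t x).
Proof.
move=> t0; have dr := is_derive_invsqrt t t0.
have dz := is_derive_mul dr (is_derive_cst ((v - x) : R) t (1 : R)).
have := is_derive_compose (is_derive_gcdf _) dz.
by move/is_derive_eq; apply; rewrite /= /heat_xx; ring.
Qed.

Lemma is_derive_heat_xx_t v t x (r := (Num.sqrt t)^-1) (z := r * (v - x)) :
  0 < t -> is_derive t 1 (fun t => heat_xx v t x)
    (r ^+ 4 * (z * gpdf z - 2^-1 * (z * (z ^+ 2 - 1) * gpdf z))).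
Proof.
move=> t0; have dr := is_derive_invsqrt t t0.
have dz := is_derive_mul dr (is_derive_cst ((v - x) : R) t (1 : R)).
have := is_derive_mul (is_derive_mul dr dr)
  (is_derive_compose (is_derive_gpdf1 _) dz).
move/is_derive_eq; apply; rewrite /= /z /r; field.
by rewrite lt0r_neq0 ?sqrtr_gt0.
Qed.

End gaussian.

(** * Estimates for the heat flow, uniform over times at least delta *)

Section heat_estimates.
Context {R : realType}.
Variables (v a delta : R).
Hypothesis delta_gt0 : 0 < delta.
Hypothesis adelta : a = (Num.sqrt delta)^-1.
(** One constant for all three regularity hypotheses of [lindeberg_tent_sum]: the space estimates
    need powers a^3 and the time estimate a^4, with [a] bounding t^(-1/2). *)
Let C := 32 * (a ^+ 3 + a ^+ 4).

Let r_bound t : delta <= t -> 0 <= (Num.sqrt t)^-1 <= a.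
Proof.
move=> dt; rewrite invr_ge0 sqrtr_ge0/= adelta lef_pV2 ?posrE ?sqrtr_gt0//.
  by rewrite ler_wsqrtr.
exact: lt_le_trans dt.
Qed.

Let a0 : 0 <= a. Proof. by have /andP[] := r_bound delta (lexx _); lra. Qed.

Lemma heat_xx_lipschitz t x y : delta <= t ->
  `|heat_xx v t x - heat_xx v t y| <= 16 * a ^+ 3 * `|x - y|.
Proof.
move=> /r_bound/andP[r0 ra].
set r := (Num.sqrt t)^-1 in r0 ra *.
pose F1 z := - r ^+ 3 * (((r * (v - z)) ^+ 2 - 1) * gpdf (r * (v - z))).
apply: (@lipschitz_of_derive R _ F1) => z _; first exact: is_derive_heat_xx.
rewrite /F1; set w := r * (v - z).
rewrite normrM normrN normrX (ger0_norm r0) mulrC ler_pM ?exprn_ge0//.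
  apply: gpdf_poly_bound; rewrite ler_norml; have := sqr_ge0 w; nra.
exact: lerXn2r.
Qed.

Lemma heat_second_difference t x h : delta <= t ->
  `|heat v t (x - h) + heat v t (x + h) - 2 * heat v t x - h ^+ 2 * heat_xx v t x|
    <= C * `|h| ^+ 3.
Proof.
move=> dt.
have := @second_difference_lipschitz R _ _ _ (16 * a ^+ 3) x h
  (is_derive_heat v t) (is_derive_heat_x v t)
  (fun y z => heat_xx_lipschitz t y z dt).
have a3 : 0 <= a ^+ 3 by exact: exprn_ge0.
have a4 : 0 <= a ^+ 4 by exact: exprn_ge0.
have C16 : 0 <= 16 * a ^+ 3 by rewrite mulr_ge0.
move=> /(_ C16)/le_trans; apply; rewrite ler_wpM2r ?exprn_ge0//.
by rewrite /C; lra.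
Qed.

(** A first-order expansion in time, whose derivative is [heat_xx] / 2 by the heat equation. A
    forward step keeps every intermediate time above delta, where [heat_xx] is Lipschitz in time. *)
Lemma heat_time_step t r x : delta <= t -> 0 <= r ->
  `|heat v (t + r) x - heat v t x - r / 2 * heat_xx v t x| <= C * r ^+ 2.
Proof.
move=> dt r0.
have a3 : 0 <= a ^+ 3 by exact: exprn_ge0.
have a4 : 0 <= a ^+ 4 by exact: exprn_ge0.
have gt (z : R) (w : R) : t <= w -> Num.min t w <= z <= Num.max t w -> delta <= z.
  by move=> tw /andP[]; rewrite min_l// => tz _; exact: le_trans dt tz.
have ttr : t <= t + r by rewrite lerDl.
have lip z : t <= z ->
    `|heat_xx v t x - heat_xx v z x| <= 32 * a ^+ 4 * `|t - z|.
  move=> tz; pose z_ w := (Num.sqrt w)^-1 * (v - x).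
  pose F1 w := (Num.sqrt w)^-1 ^+ 4 *
    (z_ w * gpdf (z_ w) - 2^-1 * (z_ w * (z_ w ^+ 2 - 1) * gpdf (z_ w))).
  apply: (@lipschitz_of_derive R (fun t => heat_xx v t x) F1) => w /(gt _ _ tz) dw.
    by apply: is_derive_heat_xx_t; exact: lt_le_trans dw.
  have /andP[s0 sa] := r_bound w dw.
  rewrite /F1 /z_; set s := (Num.sqrt w)^-1 in s0 sa *; set y := s * (v - x).
  have y1 : `|y * gpdf y| <= 16.
    by apply: gpdf_poly_bound; rewrite ler_norml; have := sqr_ge0 y; nra.
  have y2 : `|y * (y ^+ 2 - 1) * gpdf y| <= 16.
    by apply: gpdf_poly_bound; rewrite ler_norml; have := sqr_ge0 y; nra.
  rewrite normrM normrX (ger0_norm s0) mulrC ler_pM ?exprn_ge0//.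
    by move: y1 y2; rewrite !ler_norml; lra.
  exact: lerXn2r.
have := @taylor1_lipschitz R (fun t => heat v t x) (fun t => 2^-1 * heat_xx v t x)
  (16 * a ^+ 4) t (t + r).
rewrite (addrAC t r) subrr add0r (ger0_norm r0).
rewrite (_ : r / 2 * _ = 2^-1 * heat_xx v t x * r); last by ring.
move=> h; apply: (le_trans (h _ _ _)).
- by move=> z /(gt _ _ ttr) dz; apply: is_derive_heat_t; exact: lt_le_trans dz.
- move=> z /andP[]; rewrite min_l// => tz _.
  rewrite -mulrBr normrM ger0_norm//.
  by have := lip z tz; rewrite distrC (distrC t); lra.
- by rewrite mulr_ge0.
- by rewrite ler_wpM2r ?sqr_ge0// /C; lra.
Qed.

Lemma heat_tent_sum beta s : 0 <= beta <= 1 ->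
  (forall b, b \in s -> `|b| <= beta) ->
  `|mean01 (fun x => heat v delta (tent_sum s x)) -
    gcdf ((Num.sqrt (delta + 12^-1 * \sum_(b <- s) b ^+ 2))^-1 * v)|
  <= C * beta * \sum_(b <- s) b ^+ 2.
Proof.
(* Reading v as v - 0 exhibits the normal term as the heat flow at the space point 0. *)
move=> b01 sb; rewrite -[X in _^-1 * X](subr0 v).
have a3 : 0 <= a ^+ 3 by exact: exprn_ge0.
have a4 : 0 <= a ^+ 4 by exact: exprn_ge0.
apply: (@lindeberg_tent_sum R (heat v) (heat_xx v) delta) => //.
- move=> t _ x; apply/differentiable_continuous/derivable1_diffP.
  by have [] := is_derive_heat v t x.
- move=> t _ x; apply/differentiable_continuous/derivable1_diffP.
  by have [] := is_derive_heat_xx v t x.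
- by move=> t x h; exact: heat_second_difference.
- by move=> t r x; exact: heat_time_step.
- move=> t x y /heat_xx_lipschitz/le_trans; apply.
  by rewrite ler_wpM2r// /C; lra.
- by rewrite mulr_ge0// addr_ge0.
Qed.

End heat_estimates.

(** * The central limit theorem for finite sums *)

Section measure_mean01.
Context {R : realType}.
Local Notation mu := (@lebesgue_measure R).
Implicit Types (A : set R) (F : R -> R).

Lemma subset01_fin_num A : measurable A -> A `<=` `[0, 1] -> mu A \is a fin_num.
Proof.
move=> mA A01; rewrite ge0_fin_numE//.
apply: (@le_lt_trans _ _ (mu `[0, 1]%classic)); first by rewrite le_measure ?inE.
by rewrite lebesgue_measure_itv/= lte_fin ltr01 ltry.
Qed.

Lemma measure_Rintegral A : measurable A -> A `<=` `[0, 1] ->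
  fine (mu A) = \int[mu]_(x in `[0, 1]) (\1_A x : R).
Proof.
by move=> mA A01; rewrite /Rintegral integral_indic// (setIidl A01).
Qed.

Lemma integrable_indic01 A : measurable A ->
  mu.-integrable `[0, 1] (EFin \o (\1_A : R -> R)).
Proof.
move=> mA; apply: measurable_bounded_integrable => //.
- by rewrite /= lebesgue_measure_itv/= lte_fin ltr01 ltry.
- exists 1; split => // M M1 x _ /=.
  by rewrite indicE (le_trans _ (ltW M1))//; case: (x \in A); rewrite ?normr1 ?normr0.
Qed.

Lemma measure_le_mean01 A F : measurable A -> A `<=` `[0, 1] -> continuous F ->
  (forall x, A x -> 1 <= F x) -> (forall x, 0 <= F x) ->
  fine (mu A) <= mean01 F.
Proof.
move=> mA A01 cF F1 F0; rewrite measure_Rintegral//.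
apply: le_Rintegral => //; [exact: integrable_indic01|exact: mean01_integrable|].
move=> x _; rewrite indicE; have [/set_mem/F1//|_] := boolP (x \in A).
exact: F0.
Qed.

Lemma mean01_le_measure A F : measurable A -> A `<=` `[0, 1] -> continuous F ->
  (forall x, 0 <= x <= 1 -> ~ A x -> F x <= 0) -> (forall x, F x <= 1) ->
  mean01 F <= fine (mu A).
Proof.
move=> mA A01 cF F0 F1; rewrite measure_Rintegral//.
apply: le_Rintegral => //; [exact: mean01_integrable|exact: integrable_indic01|].
move=> x x01; rewrite indicE; have [_|/negP xA] := boolP (x \in A); first exact: F1.
by apply: F0 => [|Ax]; [move: x01; rewrite /= in_itv|apply: xA; rewrite inE].
Qed.
End measure_mean01.

Section finite_clt.
Context {R : realType}.
Local Notation mu := (@lebesgue_measure R).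

Lemma gcdf_lipschitz (x y : R) : `|gcdf x - gcdf y| <= 16 * `|x - y|.
Proof.
apply: (@lipschitz_of_derive R _ gpdf) => z _; first exact: is_derive_gcdf.
rewrite -[gpdf z]mul1r; apply: gpdf_poly_bound; rewrite normr1.
have := sqr_ge0 z; nra.
Qed.

(** The factor |u| + 4 arises from |w - u| <= 2 e and (1 - q^(-1/2)) |w| <= e (|u| + 2). In use, w
    is a shifted threshold and q the variance after smoothing. *)
Lemma gcdf_rescale (u w d e : R) : `|w - u| <= 2 * e -> 0 <= d <= e -> e <= 1 ->
  forall q, 1 <= q <= 1 + d ->
  `|gcdf ((Num.sqrt q)^-1 * w) - gcdf u| <= 16 * (`|u| + 4) * e.
Proof.
move=> wu /andP[d0 de] e1 q /andP[q1 qd].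
apply: (le_trans (gcdf_lipschitz _ _)); rewrite -mulrA ler_wpM2l//.
have q0 : 0 <= q by lra.
set k := Num.sqrt q.
have k1 : 1 <= k by rewrite -[leLHS]sqrtr1 ler_wsqrtr.
have kk : k * k = q by rewrite -expr2 sqr_sqrtr.
have kd : k <= 1 + d by nra.
have k0 : 0 < k by lra.
have r1 : k^-1 <= 1 by rewrite invf_le1.
have rd : 1 - d <= k^-1.
  by rewrite -[leRHS]mul1r ler_pdivlMr//; nra.
rewrite (_ : _ - u = (w - u) - (1 - k^-1) * w); last by ring.
apply: (le_trans (ler_normB _ _)); rewrite normrM.
rewrite (ger0_norm (_ : 0 <= 1 - k^-1)); last by lra.
have w2 : `|w| <= `|u| + 2.
  rewrite -[w](subrK u) (le_trans (ler_normD _ _))// addrC lerD2l.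
  by rewrite (le_trans wu)//; lra.
have := ler_pM (_ : 0 <= 1 - k^-1) (normr_ge0 w) (_ : 1 - k^-1 <= e) w2.
move=> /(_ ltac:(lra) ltac:(lra)); lra.
Qed.

(** The set [A] agrees with a half-line event of the finite sum only up to a slack e, which leaves
    room for truncating a series. Smoothing for time e^4 means a standard deviation e^2, so
    thresholds moved by 2 e sandwich [A] up to normal tails beyond 1/e, bounded by [kap]. *)
Lemma finite_clt (u e kap beta : R) (s : seq R) (A : set R)
    (a := (Num.sqrt (e ^+ 4))^-1) (q := 12^-1 * \sum_(b <- s) b ^+ 2) :
  0 < e <= 1 -> measurable A -> A `<=` `[0, 1] ->
  (forall x, A x -> tent_sum s x <= u + e) ->
  (forall x, 0 <= x <= 1 -> ~ A x -> u - e <= tent_sum s x) ->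
  1 - e ^+ 4 <= q <= 1 ->
  0 <= beta <= 1 -> (forall b, b \in s -> `|b| <= beta) ->
  1 - gcdf e^-1 <= kap -> gcdf (- e^-1) <= kap ->
  `|fine (mu A) - gcdf u| <=
    kap + 16 * (`|u| + 4) * e + 12 * (32 * (a ^+ 3 + a ^+ 4)) * beta.
Proof.
move=> /andP[e0 e1] mA A01 Ale leA /andP[qd q1] b01 sb kap1 kap0.
have e4 : 0 < e ^+ 4 by exact: exprn_gt0.
have e41 : e ^+ 4 <= e by rewrite exprS ler_piMr ?(ltW e0)// exprn_ile1 ?(ltW e0).
have sqe : Num.sqrt (e ^+ 4) = e ^+ 2.
  by rewrite (exprM e 2 2) sqrtr_sqr ger0_norm// sqr_ge0.
set C := 32 * _.
have err w : `|w - u| <= 2 * e ->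
    `|mean01 (fun x => heat w (e ^+ 4) (tent_sum s x)) - gcdf u| <=
    16 * (`|u| + 4) * e + 12 * C * beta.
  move=> wu.
  have h1 := @heat_tent_sum R w a (e ^+ 4) e4 erefl beta s b01 sb.
  have h2 := @gcdf_rescale u w (e ^+ 4) e wu _ e1 (e ^+ 4 + q).
  have C0 : 0 <= C.
    by rewrite /C mulr_ge0// addr_ge0// exprn_ge0// invr_ge0 sqrtr_ge0.
  have Cb : 0 <= C * beta by rewrite mulr_ge0//; case/andP: b01.
  (* The sum of squares is 12 q with q <= 1. *)
  have h3 : C * beta * \sum_(b <- s) b ^+ 2 <= 12 * C * beta.
    rewrite (_ : \sum_(b <- s) b ^+ 2 = 12 * q); last by rewrite /q; field.
    by have := ler_wpM2l Cb q1; lra.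
  have {}h2 := h2 ltac:(lra) ltac:(lra).
  rewrite -/C -/q in h1; have {}h1 := le_trans h1 h3.
  by rewrite [leRHS]addrC; exact: (le_trans (ler_distD _ _ _) (lerD h1 h2)).
have cheat w : continuous (fun x => heat w (e ^+ 4) (tent_sum s x)).
  apply: continuous_comp_tent_sum => x.
  apply/differentiable_continuous/derivable1_diffP.
  by have [] := is_derive_heat w (e ^+ 4) x.
have kap_ge0 : 0 <= kap by rewrite (le_trans (gcdf_ge0 (- e^-1))).
have e2V : (e ^+ 2)^-1 * e = e^-1 by field; rewrite lt0r_neq0.
have e2V0 : 0 <= (e ^+ 2)^-1 by rewrite invr_ge0 sqr_ge0.
rewrite ler_norml; apply/andP; split.
- have := err (u - 2 * e).
  rewrite (_ : u - 2 * e - u = - (2 * e)); last by ring.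
  rewrite normrN ger0_norm; last by lra.
  move=> /(_ (lexx _)); rewrite ler_norml => /andP[h _].
  (* Off [A] the sum exceeds the lowered threshold by at least e, that is 1/e standard deviations,
     so the smoothed indicator is at most [kap] there. *)
  suff : mean01 (fun x => heat (u - 2 * e) (e ^+ 4) (tent_sum s x) + - kap) <=
      fine (mu A).
    by rewrite mean01D ?mean01_cst; [lra|exact: cheat|exact: continuous_cst].
  apply: mean01_le_measure => //.
  + by apply: continuous_add; [exact: cheat|exact: continuous_cst].
  + move=> x x01 /(leA _ x01) uS; rewrite subr_le0 (le_trans _ kap0)//.
    rewrite /heat sqe gcdf_le// -e2V -[leRHS]mulrN ler_wpM2l//; lra.
  + by move=> x; rewrite lerBlDr (le_trans (gcdf_le1 _))// lerDl.
- have := err (u + 2 * e).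
  rewrite (addrAC u) subrr add0r ger0_norm; last by lra.
  move=> /(_ (lexx _)); rewrite ler_norml => /andP[_ h].
  (* On [A] the sum lies at least e below the raised threshold, so the smoothed indicator is at
     least 1 - [kap] there. *)
  suff : fine (mu A) <=
      mean01 (fun x => heat (u + 2 * e) (e ^+ 4) (tent_sum s x) + kap).
    by rewrite mean01D ?mean01_cst; [lra|exact: cheat|exact: continuous_cst].
  apply: measure_le_mean01 => //.
  + by apply: continuous_add; [exact: cheat|exact: continuous_cst].
  + move=> x /Ale uS; rewrite -lerBlDr.
    suff : gcdf e^-1 <= heat (u + 2 * e) (e ^+ 4) (tent_sum s x) by lra.
    rewrite /heat sqe gcdf_le// -e2V ler_wpM2l//; lra.
  + by move=> x; rewrite addr_ge0// gcdf_ge0.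
Qed.
End finite_clt.

(** * Passage to the infinite series *)

Section tails.
Context {R : realType}.
Implicit Types (c u : nat -> R) (N M : nat).

Lemma cvg_rsum_from u N : cvgn (series u) ->
  (fun M => \sum_(N <= k < M) u k) @ \oo --> rsum_from N u.
Proof. by rewrite -(is_cvg_series_restrict N). Qed.

Lemma summable_cvg c u : cvgn (series (fun n => `|c n|)) ->
  (forall n, `|u n| <= `|c n|) -> cvgn (series u).
Proof.
by move=> cc uc; apply: normed_cvg; apply: series_le_cvg cc => // n; exact: normr_ge0.
Qed.

Lemma summable_tail c (e : R) : cvgn (series (fun n => `|c n|)) -> 0 < e ->
  \forall M \near \oo, forall m, (M <= m)%N -> \sum_(M <= n < m) `|c n| <= e.
Proof.
move=> /cauchy_cvgP/cauchy_seriesP cc /cc[[A B] [[nA _ HA] [nB _ HB]] AB].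
exists (maxn nA nB) => // M /=; rewrite geq_max => /andP[AM BM] m Mm.
have := AB (M, m); rewrite /= ger0_norm ?sumr_ge0// => h.
by apply/ltW/h; split; [exact: HA|exact: HB (leq_trans BM Mm)].
Qed.

(** The terms are bounded by the sum B of the absolute values, so the squares are dominated by B
    |c_n|. *)
Lemma summable_sqr c : cvgn (series (fun n => `|c n|)) ->
  cvgn (series (fun n => c n ^+ 2)).
Proof.
move=> cc; pose B := limn (series (fun n => `|c n|)).
have cB n : `|c n| <= B.
  apply: (@le_trans _ _ (series (fun n => `|c n|) n.+1)).
    by rewrite /series/= big_nat_recr//= lerDr sumr_ge0.
  apply: nondecreasing_cvgn_le => //; apply: nondecreasing_series => k _ _.
  exact: normr_ge0.
have B0 : 0 <= B by exact: le_trans (cB 0%N).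
apply: (@series_le_cvg _ _ (fun n => B * `|c n|)).
- by move=> n; exact: sqr_ge0.
- by move=> n; rewrite mulr_ge0.
- by move=> n; rewrite -real_normK ?num_real// expr2 ler_wpM2r.
- exact: is_cvg_seriesZ cc.
Qed.

Lemma rsum_from_ge u N M : cvgn (series u) -> (forall n, 0 <= u n) ->
  \sum_(N <= n < M) u n <= rsum_from N u.
Proof.
move=> cu u0; apply: (@nondecreasing_cvgn_le _ (fun M => \sum_(N <= n < M) u n)).
  exact: nondecreasing_series.
by rewrite is_cvg_series_restrict.
Qed.

Lemma rsum_from_le u N M : cvgn (series u) -> (forall n, 0 <= u n) ->
  (N <= M)%N -> rsum_from M u <= rsum_from N u.
Proof.
move=> cu u0 NM; apply: (ler_cvg_to (cvg_rsum_from _ _ cu) (cvg_rsum_from _ _ cu)).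
near=> m; have Mm : (M <= m)%N by near: m; exact: nbhs_infty_ge.
by rewrite (big_cat_nat NM Mm)//= lerDr sumr_ge0.
Unshelve. all: by end_near. Qed.

(** Padding with zeros below N keeps the position of a coefficient equal to the exponent of its
    iterate, so a block of the series becomes a [tent_sum] in the same variable x. *)
Lemma tent_sum_mkseq (g : nat -> R) N M x : (N <= M)%N ->
  tent_sum (mkseq (fun n => if (n < N)%N then 0 else g n) M) x =
  \sum_(N <= n < M) g n * (iter n ctent x - 2^-1).
Proof.
move=> NM; rewrite /tent_sum -(big_mkord xpredT
  (fun i => (mkseq _ M)`_i * (iter i ctent x - 2^-1))) size_mkseq.
rewrite (big_cat_nat (leq0n N) NM)/= big_nat_cond big1 ?add0r; last first.
  by move=> i /andP[/andP[_ iN] _]; rewrite nth_mkseq ?iN ?mul0r//; exact: leq_trans NM.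
apply: eq_big_nat => i /andP[Ni iM].
by rewrite nth_mkseq// ltnNge Ni.
Qed.

Lemma sum_sqr_mkseq (g : nat -> R) N M : (N <= M)%N ->
  \sum_(b <- mkseq (fun n => if (n < N)%N then 0 else g n) M) b ^+ 2 =
  \sum_(N <= n < M) g n ^+ 2.
Proof.
move=> NM; rewrite big_map -[M in iota 0 M]subn0 -/(index_iota 0 M).
rewrite (big_cat_nat (leq0n N) NM)/= big_nat_cond big1 ?add0r; last first.
  by move=> i /andP[/andP[_ ->] _]; rewrite expr0n.
by apply: eq_big_nat => i /andP[Ni iM]; rewrite ltnNge Ni.
Qed.

End tails.

Section tent_series.
Context {R : realType}.
Variable c : nat -> R.
Hypothesis sum_c : cvgn (series (fun n => `|c n|)).

(** It keeps the shape of the numerator in the theorem, so that the sets there can be replaced by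
    sets defined from it; [cvg_tent_tail] turns it into one centred series starting at N. *)
Definition tent_tail (N : nat) (x : R) : R :=
  rsum_from 1 (fun n => c n * tent_iter n x) -
    \sum_(1 <= n < N) c n * tent_iter n x - 2^-1 * rsum_from N c.

Lemma cvg_tent_tail N (x : R) : (1 <= N)%N -> 0 <= x <= 1 ->
  (fun M => \sum_(N <= n < M) c n * (iter n ctent x - 2^-1)) @ \oo -->
  tent_tail N x.
Proof.
move=> N1 x01.
have cf : cvgn (series (fun n => c n * tent_iter n x)).
  apply: summable_cvg sum_c _ => n; rewrite normrM ler_piMr//.
  by rewrite iter_tentE// ler_norml; have := iter_ctent01 n x x01; lra.
have cc : cvgn (series c) by exact: summable_cvg sum_c _.
have := cvgB (cvgB (cvg_rsum_from _ 1 cf)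
    (cvg_cst (\sum_(1 <= n < N) c n * tent_iter n x)))
  (cvgM (cvg_cst (2^-1 : R)) (cvg_rsum_from _ N cc)).
move=> h; apply: (cvg_trans _ (h _ _ _ _ _)); apply: near_eq_cvg; near=> M.
have NM : (N <= M)%N by near: M; exact: nbhs_infty_ge.
rewrite /= !fctE (big_cat_nat N1 NM)/= (addrC (\sum_(1 <= n < N) _)) addrK.
rewrite mulr_sumr -sumrB; apply: eq_bigr => n _.
by rewrite iter_tentE//; ring.
Unshelve. all: by end_near. Qed.

Lemma tent_tail_approx N M (x e : R) : (1 <= N)%N -> (N <= M)%N -> 0 <= x <= 1 ->
  (forall m, (M <= m)%N -> \sum_(M <= n < m) `|c n| <= e) ->
  `|tent_tail N x - \sum_(N <= n < M) c n * (iter n ctent x - 2^-1)| <= e.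
Proof.
move=> N1 NM x01 Me.
have h := cvg_norm (cvgB (cvg_tent_tail N x N1 x01)
  (cvg_cst (\sum_(N <= n < M) c n * (iter n ctent x - 2^-1)))).
apply: (cvgr_to_le (h _ _ _)).
near=> m; have Mm : (M <= m)%N by near: m; exact: nbhs_infty_ge.
rewrite /= !fctE (big_cat_nat NM Mm)/= (addrC (\sum_(N <= n < M) _)) addrK.
apply: (le_trans (ler_norm_sum _ _ _)); apply: (le_trans _ (Me m Mm)).
apply: ler_sum => n _; rewrite normrM ler_piMr//.
by rewrite ler_norml; have := iter_ctent01 n x x01; lra.
Unshelve. all: by end_near. Qed.

(** On [0, 1] the tail is a pointwise limit of continuous finite sums. *)
Lemma measurable_tent_tail N : (1 <= N)%N ->
  measurable_fun (`[0, 1]%classic : set R) (tent_tail N).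
Proof.
move=> N1; apply: (@measurable_fun_cvg _ _ _ _
  (fun M x => tent_sum (mkseq (fun n => if (n < N)%N then 0 else c n) (maxn N M)) x)).
  move=> M; apply: measurable_funTS; apply: continuous_measurable_fun.
  exact: continuous_tent_sum.
move=> x; rewrite /= in_itv/= => x01.
apply: cvg_trans (cvg_tent_tail N x N1 x01); apply: near_eq_cvg; near=> M.
have NM : (N <= M)%N by near: M; exact: nbhs_infty_ge.
by rewrite (maxn_idPr NM) tent_sum_mkseq.
Unshelve. all: by end_near. Qed.

End tent_series.

(** * Choice of the parameters and the limit theorem *)

Theorem theorem1p1 (R : realType) (c : nat -> R) :
  cvgn (fun M => \sum_(1 <= n < M) `|c n|) ->
  (forall N : nat, (1 <= N)%N -> 0 < rsum_from N (fun n => c n ^+ 2)) ->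
  (fun N => c N ^+ 2 / rsum_from N (fun n => c n ^+ 2)) @ \oo --> (0 : R) ->
  let f := fun x : R => rsum_from 1 (fun n => c n * tent_iter n x) in
  let fN := fun (N : nat) (x : R) => \sum_(1 <= n < N) c n * tent_iter n x in
  forall u : R,
    (fun N : nat => @lebesgue_measure R
       [set x : R | x \in `[0, 1] /\
          (f x - fN N x - 2^-1 * rsum_from N c)
            / Num.sqrt (12^-1 * rsum_from N (fun n => c n ^+ 2)) <= u])
      @ \oo --> Phi u.
Proof.
move=> sum_c var_gt0 ratio f fN u.
have cc : cvgn (series (fun n => `|c n|)) by rewrite -(is_cvg_series_restrict 1).
have sqc := summable_sqr _ cc.
have sq_ge0 n : 0 <= c n ^+ 2 by exact: sqr_ge0.
pose V N := rsum_from N (fun n => c n ^+ 2).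
pose sg N := Num.sqrt (12^-1 * V N).
have sg_gt0 N : (1 <= N)%N -> 0 < sg N.
  by move=> N1; rewrite sqrtr_gt0 mulr_gt0 ?invr_gt0 ?var_gt0.
have sgE N : (1 <= N)%N -> sg N ^+ 2 = 12^-1 * V N.
  by move=> N1; rewrite sqr_sqrtr// mulr_ge0 ?invr_ge0// ltW// var_gt0.
pose A N := [set x : R | x \in `[0, 1] /\ tent_tail c N x / sg N <= u].
have A01 N : A N `<=` `[0, 1] by move=> x [].
have mA N : (1 <= N)%N -> measurable (A N).
  move=> N1.
  have mY : measurable_fun (`[0, 1]%classic : set R)
      (fun x => tent_tail c N x * (sg N)^-1).
    by apply: measurable_funM => //; exact: measurable_tent_tail.
  have -> : A N = `[0, 1] `&` (fun x => tent_tail c N x * (sg N)^-1) @^-1` `]-oo, u].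
    by apply/seteqP; split => x; rewrite /A /= ?in_itv.
  by apply: mY => //; exact: measurable_itv.
rewrite (_ : Phi u = (gcdf u)%:E); last by rewrite /gcdf fineK// Phi_fin_num.
apply/fine_cvgP; split.
  near=> N; apply: (subset01_fin_num (A N)) => //.
  by apply: mA; near: N; exact: nbhs_infty_ge.
apply/cvgrPdist_le => e e0; have e4 : 0 < e / 4 by rewrite divr_gt0.
(* The smoothing scale will be d = 1/w. A large w makes both the normal tails and the error linear
   in d at most e/4. *)
have [w [w1 we wG wGN]] : exists w, [/\ 1 <= w, 16 * (`|u| + 4) / (e / 4) <= w,
    1 - gcdf w <= e / 4 & gcdf (- w) <= e / 4].
  near (pinfty_nbhs R) => w; exists w; split.
  - by near: w; apply: nbhs_pinfty_ge; exact: num_real.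
  - by near: w; apply: nbhs_pinfty_ge; exact: num_real.
  - apply: (le_trans (ler_norm _)); near: w.
    by move/cvgrPdist_le : (@cvg_gcdfy R) => /(_ _ e4).
  - rewrite -[leLHS]subr0 (le_trans (ler_norm _))// distrC; near: w.
    by move/cvgNy_compNP/cvgrPdist_le : (@cvg_gcdfNy R) => /(_ _ e4).
have w0 : 0 < w by lra.
pose d := w^-1.
have d01 : 0 < d <= 1 by rewrite invr_gt0 w0 invf_le1.
have d4 : 0 < d ^+ 4 by rewrite exprn_gt0//; case/andP: d01.
have ud : 16 * (`|u| + 4) * d <= e / 4.
  by rewrite /d ler_pdivrMr// -ler_pdivrMl// mulrC.
pose a := (Num.sqrt (d ^+ 4))^-1.
pose C := 12 * (32 * (a ^+ 3 + a ^+ 4)).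
have C0 : 0 <= C.
  by rewrite !mulr_ge0// addr_ge0// exprn_ge0// invr_ge0 sqrtr_ge0.
(* The bound on the normalised coefficients: at most 1, as [finite_clt] requires, and small enough
   for C beta <= e/4; C + 1 keeps the denominator positive. *)
pose beta := Num.min 1 (e / 4 / (C + 1)).
have beta0 : 0 < beta by rewrite lt_min ltr01 divr_gt0// ltr_wpDl.
have beta1 : beta <= 1 by rewrite ge_min lexx.
have Cbeta : C * beta <= e / 4.
  apply: (@le_trans _ _ ((C + 1) * beta)); first by rewrite ler_wpM2r ?lerDl// ltW.
  by rewrite mulrC -ler_pdivlMr ?ltr_wpDl// ge_min lexx orbT.
(* Dividing by [sg N] squared, which is V N / 12, turns this ratio bound into beta^2 for the
   normalised coefficients. *)
have [N0 _ smallN0] : \forall n \near \oo, c n ^+ 2 / V n <= beta ^+ 2 / 12.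
  have b12 : 0 < beta ^+ 2 / 12 by rewrite divr_gt0// exprn_gt0.
  move/cvgrPdist_le : ratio => /(_ _ b12); apply: filterS => n.
  by rewrite sub0r normrN => /(le_trans (ler_norm _)).
near=> N.
have N1 : (1 <= N)%N by near: N; exact: nbhs_infty_ge.
have NN0 : (N0 <= N)%N by near: N; exact: nbhs_infty_ge.
have sgN := sg_gt0 N N1.
have VN : 0 < V N by exact: var_gt0.
(* The truncation point M depends on N: the discarded terms stay below d after normalisation, and
   the discarded variance is at most the fraction d^4. These are the slack and the lower bound on q
   in [finite_clt]. *)
have [M [NM tailM varM]] : exists M, [/\ (N <= M)%N,
    forall m, (M <= m)%N -> \sum_(M <= n < m) `|c n| <= d * sg N &
    V N - d ^+ 4 * V N <= \sum_(N <= n < M) c n ^+ 2].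
  near \oo%classic => M; exists M; split.
  - by near: M; exact: nbhs_infty_ge.
  - near: M; apply: summable_tail => //.
    by rewrite mulr_gt0//; case/andP: d01.
  - rewrite lerBlDr -lerBlDl (le_trans (ler_norm _))//; near: M.
    have dV : 0 < d ^+ 4 * V N by rewrite mulr_gt0.
    by move/cvgrPdist_le : (cvg_rsum_from _ N sqc) => /(_ _ dV).
pose s := mkseq (fun n => if (n < N)%N then 0 else c n / sg N) M.
have sE x : tent_sum s x =
    (\sum_(N <= n < M) c n * (iter n ctent x - 2^-1)) / sg N.
  rewrite (tent_sum_mkseq (fun n => c n / sg N))// mulr_suml.
  by apply: eq_bigr => n _; ring.
have Ss x : 0 <= x <= 1 -> `|tent_tail c N x / sg N - tent_sum s x| <= d.
  move=> x01; rewrite sE -mulrBl normrM normfV (gtr0_norm sgN) ler_pdivrMr//.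
  exact: tent_tail_approx.
have qE : 12^-1 * \sum_(b <- s) b ^+ 2 = (\sum_(N <= n < M) c n ^+ 2) / V N.
  rewrite (sum_sqr_mkseq (fun n => c n / sg N))//.
  rewrite (eq_bigr (fun n => c n ^+ 2 * (12 / V N))).
    by rewrite -mulr_suml; field; rewrite lt0r_neq0.
  by move=> n _; rewrite expr_div_n sgE//; field; rewrite lt0r_neq0.
have sb b : b \in s -> `|b| <= beta.
  case/mapP => n; rewrite mem_iota add0n => /andP[_ nM] ->.
  case: ltnP => [_|Nn]; first by rewrite normr0 ltW.
  rewrite -(@ler_pXn2r _ 2)// ?nnegrE ?(ltW beta0)//.
  rewrite real_normK ?num_real// expr_div_n sgE//.
  have := smallN0 n (leq_trans NN0 Nn); rewrite ler_pdivrMr; last first.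
    exact/var_gt0/(leq_trans N1).
  move=> cn; rewrite ler_pdivrMr; last by rewrite mulr_gt0.
  (* The ratio hypothesis compares c_n with the tail from n; for n >= N that tail is at most the one
     from N. *)
  apply: (le_trans cn); rewrite -mulrA ler_wpM2l ?sqr_ge0// ler_wpM2l//.
  exact: rsum_from_le.
have /(_ d01 (mA N N1) (A01 N)) := @finite_clt R u d (e / 4) beta s (A N).
rewrite qE /= invrK => fin.
rewrite distrC; apply: (le_trans (fin _ _ _ _ _ _ _)) => //.
- move=> x [x01 Yx]; have := Ss x x01.
  by rewrite ler_norml; lra.
- move=> x x01 nA; have := Ss x x01.
  have : u < tent_tail c N x / sg N.
    by rewrite ltNge; apply/negP => Yx; apply: nA.
  by rewrite ler_norml; lra.
- rewrite ler_pdivlMr// ler_pdivrMr// mul1r mulrBl mul1r varM/=.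
  exact: rsum_from_ge.
- by rewrite (ltW beta0).
(* Three errors of at most e/4 each: normal tails, shift of the threshold, and Lindeberg
   replacement. *)
- by rewrite -/C; lra.
Unshelve. all: by end_near. Qed.
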